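(* Let $k\ge 2$ and $q\ge 1$ be integers, let $\Omega_1,\dots,\Omega_k$ be finite sets with $|\Omega_i|=q$, and let $\mu$ be a pairwise independent probability distribution on $\Omega=\Omega_1\times\cdots\times\Omega_k$ whose marginals $\mu_i$ satisfy $\mu_i(x)>0$ for all $x\in\Omega_i$. Then there is a constant $C$ depending only on $\mu$ such that the following holds for every $n$ and every choice of Fourier bases of the spaces $L^2(\Omega_i,\mu_i)$. Let $f_i\in L^2(\Omega_i^n,\mu_i^{\otimes n})$ for $i=1,\dots,k$. Let $\delta:=\max_{\sigma\in\mathbb{Z}_q^n}|\hat f_1(\sigma)|$ be the size of the largest Fourier coefficient of $f_1$, and let $D:=\deg_{-2}(f_1,\dots,f_k)$ be the sum of the $k-2$ smallest among the Fourier degrees $\deg(f_1),\dots,\deg(f_k)$. Then $$\bigl|\langle f_1,\dots,f_k\rangle_\mu\bigr|\le C^{D}\,\delta\,\prod_{i=2}^k\|f_i\|_2 .$$ Furthermore, one can always take $C=\left(k\sqrt{\tfrac{q-1}{\alpha}}\right)^3$, where $\alpha=\min_i\alpha(\mu_i)$. If all marginals $\mu_i$ are uniform, then there is a choice of complex Fourier bases of the $L^2(\Omega_i,\mu_i)$ such that, with Fourier coefficients taken with respect to these bases, the inequality holds with $C=(k\sqrt{q-1})^3$.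
   Context: Pairwise independence: for all $i<j$, $a\in\Omega_i$, $b\in\Omega_j$, $\Pr_{x\sim\mu}[x_i=a\wedge x_j=b]=\mu_i(a)\mu_j(b)$, where $\mu_i$ is the marginal of $\mu$ on $\Omega_i$. $\alpha(\mu_i)$ is the minimum non-zero probability of an atom of $\mu_i$. $L^2(\Omega_i^n,\mu_i^{\otimes n})$ is the space of functions $\Omega_i^n\to\mathbb{C}$ with inner product $\langle f,g\rangle=\mathbb{E}[f\overline g]$ and norms $\|f\|_p=(\mathbb{E}|f|^p)^{1/p}$ under the product measure $\mu_i^{\otimes n}$. Fourier basis: an orthonormal basis $\chi^i_0,\dots,\chi^i_{q-1}$ of $L^2(\Omega_i,\mu_i)$ with $\chi^i_0\equiv 1$. For $\sigma\in\mathbb{Z}_q^n$ (a multi-index) put $\chi^i_\sigma(x_1,\dots,x_n)=\prod_{j=1}^n\chi^i_{\sigma_j}(x_j)$; these form an orthonormal basis of $L^2(\Omega_i^n,\mu_i^{\otimes n})$. The Fourier coefficients of $f\in L^2(\Omega_i^n,\mu_i^{\otimes n})$ are $\hat f(\sigma)=\langle f,\chi^i_\sigma\rangle$. Let $|\sigma|$ be the number of coordinates $j$ with $\sigma_j\ne 0$. The Fourier degree $\deg(f)$ is the infimum of all $d\in\mathbb{Z}$ such that $\hat f(\sigma)=0$ whenever $|\sigma|>d$ (so $\deg(0)=-\infty$; conventions $C^{-\infty}=0$, $0^0=1$, empty sum $=0$). Noisy inner product: $\langle f_1,\dots,f_k\rangle_\mu=\mathbb{E}_X\left[\prod_{i=1}^k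 f_i(X_i)\right]$, where $X$ is a random $k\times n$ matrix whose $n$ columns are i.i.d. samples from $\mu$, and $X_i\in\Omega_i^n$ is the $i$-th row of $X$. *)

(* Defs.v *)
From mathcomp Require Export all_boot all_order all_algebra.
From mathcomp Require Export all_classical all_reals all_analysis.
From mathcomp.real_closed Require Export complex.

Set Implicit Arguments.
Unset Strict Implicit.
Unset Printing Implicit Defensive.

Import Order.TTheory GRing.Theory Num.Theory ComplexField.

Local Open Scope classical_set_scope.
Local Open Scope ring_scope.
Local Open Scope complex_scope.

Definition cabs (R : realType) (z : R[i]) : R := Normc.normc z.

Definition is_distr (R : realType) (T : finType) (w : T -> R) : Prop :=
  (forall x, 0 <= w x) /\ \sum_x w x = 1.

Definition expect (R : realType) (T : finType) (w : T -> R) (f : T -> R[i]) :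
  R[i] := \sum_x (w x)%:C * f x.

Definition inner (R : realType) (T : finType) (w : T -> R) (f g : T -> R[i]) :
  R[i] := expect w (fun x => f x * (g x)^*).

Definition norm2 (R : realType) (T : finType) (w : T -> R) (f : T -> R[i]) :
  R := Num.sqrt (\sum_x w x * cabs (f x) ^+ 2).

(* The initial value 1 is harmless, as atoms have probability at most 1. *)
Definition min_atom (R : realType) (T : finType) (w : T -> R) : R :=
  \big[Num.min/1]_(x | w x != 0) w x.

Definition prod_distr (R : realType) (T : finType) (n : nat) (w : T -> R)
  (x : {ffun 'I_n -> T}) : R := \prod_j w (x j).

Definition marginal (R : realType) (k : nat) (Omega : 'I_k -> finType)
  (mu : {dffun forall i : 'I_k, Omega i} -> R) (i : 'I_k) (a : Omega i) : R :=
  \sum_(x : {dffun forall j : 'I_k, Omega j} | x i == a) mu x.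

Definition pairwise_independent (R : realType) (k : nat)
  (Omega : 'I_k -> finType) (mu : {dffun forall i : 'I_k, Omega i} -> R) :
  Prop :=
  forall i j : 'I_k, (i < j)%N -> forall (a : Omega i) (b : Omega j),
    \sum_(x : {dffun forall l : 'I_k, Omega l} | (x i == a) && (x j == b)) mu x
      = marginal mu a * marginal mu b.

Definition min_marginal_atom (R : realType) (k : nat)
  (Omega : 'I_k -> finType) (mu : {dffun forall i : 'I_k, Omega i} -> R) : R :=
  \big[Num.min/1]_(i < k) min_atom (marginal mu (i := i)).

(* A k x n matrix is given by its n columns; this is its i-th row. *)
Definition mrow (k n : nat) (Omega : 'I_k -> finType)
  (X : {ffun 'I_n -> {dffun forall i : 'I_k, Omega i}}) (i : 'I_k) :
  {ffun 'I_n -> Omega i} := [ffun j => X j i].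

Definition noisy_inner (R : realType) (k n : nat) (Omega : 'I_k -> finType)
  (mu : {dffun forall i : 'I_k, Omega i} -> R)
  (f : forall i : 'I_k, {ffun 'I_n -> Omega i} -> R[i]) : R[i] :=
  expect (prod_distr mu) (fun X => \prod_(i < k) f i (mrow X i)).

(* The index set Z_q is 'I_q, which is also correct for q = 1. *)

Definition fourier_basis (R : realType) (q : nat) (T : finType) (w : T -> R)
  (chi : 'I_q -> T -> R[i]) : Prop :=
  [/\ forall s : 'I_q, s = 0%N :> nat -> forall x, chi s x = 1,
      forall s t : 'I_q, inner w (chi s) (chi t) = (s == t)%:R
    & forall g : T -> R[i], exists c : 'I_q -> R[i],
        forall x, g x = \sum_s c s * chi s x].

Definition fourier_char (R : realType) (q n : nat) (T : finType)
  (chi : 'I_q -> T -> R[i]) (sigma : {ffun 'I_n -> 'I_q})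
  (x : {ffun 'I_n -> T}) : R[i] := \prod_j chi (sigma j) (x j).

Definition fourier_coef (R : realType) (q n : nat) (T : finType) (w : T -> R)
  (chi : 'I_q -> T -> R[i]) (f : {ffun 'I_n -> T} -> R[i])
  (sigma : {ffun 'I_n -> 'I_q}) : R[i] :=
  inner (prod_distr w) f (fourier_char chi sigma).

Definition max_coef (R : realType) (q n : nat) (T : finType) (w : T -> R)
  (chi : 'I_q -> T -> R[i]) (f : {ffun 'I_n -> T} -> R[i]) : R :=
  \big[Num.max/0]_(sigma : {ffun 'I_n -> 'I_q}) cabs (fourier_coef w chi f sigma).

Definition weight (q n : nat) (sigma : {ffun 'I_n -> 'I_q}) : nat :=
  #|[set j | (sigma j : nat) != 0%N]%SET|.

Definition fourier_degree (R : realType) (q n : nat) (T : finType) (w : T -> R)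
  (chi : 'I_q -> T -> R[i]) (f : {ffun 'I_n -> T} -> R[i]) : \bar R :=
  ereal_inf [set (d%:~R)%:E | d in [set d : int |
    forall sigma : {ffun 'I_n -> 'I_q},
      d < (weight sigma)%:Z -> fourier_coef w chi f sigma = 0]].

Definition deg_minus2 (R : realType) (q k n : nat) (Omega : 'I_k -> finType)
  (mu : {dffun forall i : 'I_k, Omega i} -> R)
  (chi : forall i : 'I_k, 'I_q -> Omega i -> R[i])
  (f : forall i : 'I_k, {ffun 'I_n -> Omega i} -> R[i]) : \bar R :=
  (\sum_(d <- take (k - 2) (sort <=%O
      [seq fourier_degree (marginal mu (i := i)) (chi i) (f i)
         | i <- enum 'I_k])) d)%E.

(* C^D for C >= 0 and D in Z u {-oo}, with C^(-oo) = 0 and 0^0 = 1 (powRr0);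
   the value at +oo is never used, Fourier degrees being at most n. *)
Definition epow (R : realType) (C : R) (D : \bar R) : R :=
  match D with
  | EFin d => C `^ d
  | _ => 0
  end.

(* Main.v *)
(** Expanding every [f_i] in its Fourier basis turns the noisy inner product into
    a sum over families of multi-indices [sigma_1, ..., sigma_k] of the product of
    the Fourier coefficients with, for each column [j], the moment
    [T = E (\prod_i chi^i_(sigma_i j))].  Pairwise independence kills a column in
    which exactly one or two of the [sigma_i j] are nonzero.  Hence each nonzero
    term has at least three nontrivial entries in every column that is not
    trivial, one of them in a row other than the two of largest degree: the number
    of nontrivial columns is at most [D], and the total weight
    [\sum_i |sigma_i|] is at most [3 D].  Paying a factor [c] for each nontrivial
    entry therefore costs at most [c ^ (3 D)].

    Once [|fhat_1|] is bounded by [delta], what is left is a form with nonnegative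
    coefficients in the [|fhat_i|], [i >= 2], which is a tensor power over the
    columns; such bounds tensorize, so one column suffices.  There, with
    [c = k sqrt (q - 1) M] where [M] bounds the characters, Bessel's inequality for
    the first index and Cauchy-Schwarz for the others reduce the claim to an
    elementary inequality over the patterns of nontrivial entries. *)

Require Import Defs.
From mathcomp Require Import cyclic separable cyclotomic.
From mathcomp Require Import ring lra zify.

Import Order.TTheory GRing.Theory Num.Theory.
Local Open Scope ring_scope.
Local Open Scope complex_scope.

Set Implicit Arguments.
Unset Strict Implicit.
Unset Printing Implicit Defensive.

(** * The one-column inequality *)

(** The gap between the two sides is half the double sum of [(g s - g t) ^+ 2] over [A]. *)
Lemma sqr_sum_le (R : realFieldType) (S : finType) (A : {set S}) (g : S -> R) :
  (\sum_(s in A) g s) ^+ 2 <= #|A|%:R * \sum_(s in A) g s ^+ 2.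
Proof.
have: 0 <= \sum_(s in A) \sum_(t in A) (g s - g t) ^+ 2.
  by apply: sumr_ge0 => s _; apply: sumr_ge0 => t _; apply: sqr_ge0.
have -> : \sum_(s in A) \sum_(t in A) (g s - g t) ^+ 2 =
    (#|A|%:R * \sum_(s in A) g s ^+ 2 - (\sum_(s in A) g s) ^+ 2) *+ 2.
  transitivity (\sum_(s in A) (g s ^+ 2 *+ #|A| - (g s * \sum_(t in A) g t) *+ 2
                 + \sum_(t in A) g t ^+ 2)).
    apply: eq_bigr => s _; under eq_bigr do rewrite sqrrB.
    rewrite big_split /= sumrB sumr_const; congr (_ - _ + _).
    by rewrite mulr_sumr sumrMnl.
  rewrite big_split /= sumrB sumr_const !sumrMnl -mulr_suml expr2 -mulr_natl.
  by rewrite !mulr2n; ring.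
by rewrite pmulrn_lge0// subr_ge0.
Qed.

Lemma sum_le_sqrt (R : rcfType) (S : finType) (A : {set S}) (g : S -> R) :
  \sum_(s in A) g s <= Num.sqrt #|A|%:R * Num.sqrt (\sum_(s in A) g s ^+ 2).
Proof.
rewrite -sqrtrM//; apply: le_trans (ler_norm _) _.
by rewrite -sqrtr_sqr ler_wsqrtr// sqr_sum_le.
Qed.

(* The coefficient left to a pattern of [r] nontrivial coordinates among the
   last [k - 1] functions: a pattern with [r = 2] must involve the first function
   too, which costs one more factor [1 / k]. *)
Definition pattern_weight (R : realFieldType) (k r : nat) : R :=
  match r with
  | 0 => 1
  | 1 => 0
  | 2 => k%:R^-1 ^+ 3
  | _ => (1 + k%:R^-1) * k%:R^-1 ^+ r
  end.

Lemma pattern_weight_ge0 (R : realFieldType) (k r : nat) :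
  0 <= pattern_weight R k r.
Proof.
have e0 : 0 <= k%:R^-1 :> R by rewrite invr_ge0.
by case: r => [|[|[|r]]] //=; rewrite ?mulr_ge0 ?addr_ge0 ?exprn_ge0.
Qed.

(** Passing from [r] to [r + 1] multiplies the left side by [(k - r - 3) / ((r + 4) k)], at most
    1/2; the case [r = 0] is [(k + 1) k (k - 1) (k - 2) <= k ^ 4]. *)
Lemma bin_geometric (R : realFieldType) (k r : nat) : (0 < k)%N ->
  (1 + k%:R^-1) * ('C(k, r.+3)%:R * k%:R^-1 ^+ r.+3) <= 6^-1 * 2^-1 ^+ r :> R.
Proof.
move=> k0; have kR : 0 < k%:R :> R by rewrite ltr0n.
elim: r => [|r IH].
  rewrite mulr1.
  have -> : (1 + k%:R^-1) * ('C(k, 3)%:R * k%:R^-1 ^+ 3) =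
     (k.+1%:R * 'C(k, 3)%:R) / k%:R ^+ 4 :> R.
    by rewrite -natr1; field; rewrite gt_eqF.
  rewrite ler_pdivrMr ?exprn_gt0// -[_ * k%:R ^+ 4]mulrC ler_pdivlMr//.
  rewrite -natrX -!natrM ler_nat.
  have := bin_ffact k 3; rewrite !ffactnS ffactn0 muln1 (_ : 3`! = 6)// => e.
  rewrite -mulnA e; case: k {k0 kR e} => [|[|k]] //=.
  by rewrite !expnS expn0; nia.
have e : 'C(k, r.+4)%:R * k%:R^-1 ^+ r.+4 * 2 <= 'C(k, r.+3)%:R * k%:R^-1 ^+ r.+3 :> R.
  have t0 : 0 <= k%:R^-1 ^+ r.+3 :> R by rewrite exprn_ge0// invr_ge0 ltW.
  rewrite [_ ^+ r.+4]exprS; move: (_ ^+ r.+3) t0 => t t0.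
  suff h : 2 * 'C(k, r.+4)%:R * k%:R^-1 <= 'C(k, r.+3)%:R :> R.
    apply: le_trans (ler_wpM2r t0 h).
    by rewrite le_eqVlt; apply/predU1P; left; ring.
  rewrite ler_pdivrMr// -!natrM ler_nat.
  by have := leq_mul (leqnn 'C(k, r.+3)) (leq_subr r.+3 k);
    have := mul_bin_left k r.+3; nia.
have a0 : 0 <= 1 + k%:R^-1 :> R by rewrite addr_ge0 ?invr_ge0 ?ltW.
have := ler_wpM2l a0 e; rewrite [2^-1 ^+ _]exprS; lra.
Qed.

(** The term [r = 2] takes at most 1/8, by [4 (k - 1) <= k ^ 2], and the terms from 3 on are
    dominated by a geometric series of sum 1/3. The value 1/2 is the largest total that the last
    step of [pattern_ineq_normalized] tolerates. *)
Lemma sum_pattern_weight (R : realFieldType) (k : nat) : (0 < k)%N ->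
  \sum_(2 <= r < k.+1) 'C(k, r)%:R * pattern_weight R k r <= 2^-1.
Proof.
move=> k0; have kR : 0 < k%:R :> R by rewrite ltr0n.
have h2 : 'C(k, 2)%:R * k%:R^-1 ^+ 3 <= 8^-1 :> R.
  have -> : 'C(k, 2)%:R * k%:R^-1 ^+ 3 = 'C(k, 2)%:R / k%:R ^+ 3 :> R.
    by field; rewrite gt_eqF.
  rewrite ler_pdivrMr ?exprn_gt0// -[_ * k%:R ^+ 3]mulrC ler_pdivlMr//.
  rewrite -natrX -natrM ler_nat.
  have := bin_ffact k 2; rewrite !ffactnS ffactn0 muln1 (_ : 2`! = 2)// => e.
  have h : (4 * k.-1 <= k * k)%N by nia.
  by have := leq_mul (leqnn k) h; rewrite !expnS expn0; nia.
have h3 m : \sum_(0 <= r < m) 'C(k, r.+3)%:R * pattern_weight R k r.+3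
    <= 3^-1 * (1 - 2^-1 ^+ m).
  elim: m => [|m IH]; first by rewrite big_geq// subrr mulr0.
  rewrite big_nat_recr//=; apply: le_trans (lerD IH _) _.
    by rewrite mulrCA; apply: bin_geometric.
  by rewrite exprS le_eqVlt; apply/predU1P; left; field.
case: k {k0 kR} h2 h3 => [|[|k]] h2 h3; try by rewrite big_geq// invr_ge0.
rewrite big_ltn// (big_addn 0 _ 3); under eq_bigr do rewrite addn3.
apply: le_trans (lerD h2 (h3 _)) _.
have : 0 <= 2^-1 ^+ (k.+3 - 3) :> R by rewrite exprn_ge0.
by move: (_ ^+ _) => t; lra.
Qed.

(** The empty pattern contributes [p], the product of all [y i], and singletons have weight 0. For a
    pattern containing [i] and [j], the product is at most [x i * x j], hence at most [1 - p ^+ 2],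
    because [y i] and [y j] are at least [p]. As the remaining weights sum to at most 1/2, it
    suffices that [p + (1 - p ^+ 2) / 2 <= 1], that is, [(1 - p) ^+ 2 >= 0]. *)
Lemma pattern_ineq_normalized (R : realFieldType) (I : finType) (x y : I -> R) :
  (0 < #|I|)%N -> (forall i, 0 <= x i) -> (forall i, 0 <= y i) ->
  (forall i, x i ^+ 2 + y i ^+ 2 = 1) ->
  \sum_(P : {set I}) pattern_weight R #|I| #|P| *
    \prod_i (if i \in P then x i else y i) <= 1.
Proof.
move=> I0 x0 y0 xy.
have x1 i : x i <= 1 by rewrite -(@expr_le1 _ 2)// -(xy i) lerDl sqr_ge0.
have y1 i : y i <= 1 by rewrite -(@expr_le1 _ 2)// -(xy i) lerDr sqr_ge0.
pose p := \prod_i y i.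
have p0 : 0 <= p by apply: prodr_ge0 => i _.
have x2 i : x i ^+ 2 <= 1 - p ^+ 2.
  rewrite -(xy i) lerBrDr lerD2l ler_pXn2r ?nnegrE// /p (bigD1 i)//=.
  by rewrite ler_piMr// prodr_ile1// => j _; rewrite y0 y1.
have big_pattern (P : {set I}) : (1 < #|P|)%N ->
    \prod_i (if i \in P then x i else y i) <= 1 - p ^+ 2.
  case/card_gt1P => i [j [iP jP ij]].
  rewrite (bigD1 i)//= iP (bigD1 j)/= 1?eq_sym// jP mulrA.
  set z := \prod_(_ | _) _.
  have z1 : z <= 1 by apply: prodr_ile1 => l _; case: ifP; rewrite ?x0 ?x1 ?y0 ?y1.
  apply: le_trans (ler_piMr (mulr_ge0 (x0 i) (x0 j)) z1) _.
  have := x2 i; have := x2 j; have := sqr_ge0 (x i - x j); nra.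
rewrite (bigID (fun P : {set I} => #|P| < 2)%N)/=.
have -> : \sum_(P : {set I} | (#|P| < 2)%N) pattern_weight R #|I| #|P| *
    \prod_i (if i \in P then x i else y i) = p.
  rewrite (bigD1 finset.set0) ?cards0//= [X in _ + X]big1 ?addr0 ?mul1r.
    by apply: eq_bigr => i _; rewrite inE.
  move=> P /andP[]; rewrite -cards_eq0; case: #|P| => [|[|]]//= _ _.
  by rewrite mul0r.
have : \sum_(P : {set I} | ~~ (#|P| < 2)%N) pattern_weight R #|I| #|P| *
    \prod_i (if i \in P then x i else y i) <= 2^-1 * (1 - p ^+ 2).
  have p1 : 0 <= 1 - p ^+ 2.
    by rewrite subr_ge0 expr_le1// prodr_ile1// => i _; rewrite y0 y1.
  apply: le_trans (ler_wpM2r p1 (sum_pattern_weight R I0)).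
  have -> : \sum_(2 <= r < #|I|.+1) 'C(#|I|, r)%:R * pattern_weight R #|I| r =
      \sum_(P : {set I} | ~~ (#|P| < 2)%N) pattern_weight R #|I| #|P|.
    have lt_card (P : {set I}) : (#|P| < #|I|.+1)%N by rewrite ltnS max_card.
    rewrite big_geq_mkord /= [RHS](partition_big
      (fun P : {set I} => Ordinal (lt_card P)) (fun r => (1 < r)%N))/=.
      apply: eq_bigr => r r1; rewrite -card_draws mulr_natl -sumr_const.
      apply: eq_big => [P|P]; last by rewrite inE => /eqP ->.
      rewrite inE -val_eqE /= -leqNgt andb_idl// => /eqP ->; exact: r1.
    by move=> P; rewrite -leqNgt.
  rewrite mulr_suml; apply: ler_sum => P; rewrite -leqNgt => /big_pattern.
  by apply: ler_wpM2l; apply: pattern_weight_ge0.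
by have := sqr_ge0 (1 - p); nra.
Qed.

(** Both sides are homogeneous of degree one in each pair [(x i, y i)], so the pairs may be scaled
    to the unit circle. *)
Lemma pattern_ineq (R : rcfType) (I : finType) (x y : I -> R) :
  (0 < #|I|)%N -> (forall i, 0 <= x i) -> (forall i, 0 <= y i) ->
  \sum_(P : {set I}) pattern_weight R #|I| #|P| *
    \prod_i (if i \in P then x i else y i)
    <= \prod_i Num.sqrt (x i ^+ 2 + y i ^+ 2).
Proof.
move=> I0 x0 y0; pose N i := Num.sqrt (x i ^+ 2 + y i ^+ 2).
have N2 i : N i ^+ 2 = x i ^+ 2 + y i ^+ 2 by rewrite sqr_sqrtr// addr_ge0 ?sqr_ge0.
(* The default pair [(0, 1)] keeps the normalization where [x i] and [y i] both vanish. *)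
pose X i := if N i == 0 then 0 else x i / N i.
pose Y i := if N i == 0 then 1 else y i / N i.
have N0 i : 0 <= N i by apply: sqrtr_ge0.
have xy0 i : N i == 0 -> (x i = 0) * (y i = 0).
  move/eqP => Ni; have := N2 i; rewrite Ni expr0n /= => /esym/eqP.
  by rewrite paddr_eq0 ?sqr_ge0// !sqrf_eq0 => /andP[/eqP -> /eqP ->].
have xE i : x i = N i * X i.
  rewrite /X; case: ifPn => [/xy0 ->|Ni]; first by rewrite mulr0.
  by rewrite mulrC divfK.
have yE i : y i = N i * Y i.
  rewrite /Y; case: ifPn => [Ni|Ni]; first by rewrite (eqP Ni) mul0r (xy0 _ Ni).
  by rewrite mulrC divfK.
have XY i : X i ^+ 2 + Y i ^+ 2 = 1.
  rewrite /X /Y; case: ifPn => [_|Ni]; first by rewrite expr0n expr1n add0r.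
  by rewrite !expr_div_n -mulrDl -N2 divff// expf_neq0.
have X0 i : 0 <= X i by rewrite /X; case: ifP => // _; rewrite divr_ge0.
have Y0 i : 0 <= Y i by rewrite /Y; case: ifP => // _; rewrite divr_ge0.
have := pattern_ineq_normalized I0 X0 Y0 XY.
have NN : 0 <= \prod_i N i by apply: prodr_ge0.
move=> /(ler_wpM2l NN); rewrite mulr1; apply: le_trans.
rewrite mulr_sumr le_eqVlt; apply/predU1P; left; apply: eq_bigr => P _.
rewrite mulrCA -big_split /=; congr (_ * _); apply: eq_bigr => i _.
by case: ifP.
Qed.

(** * Tensorization over the columns *)

Definition fcons (T : finType) (n : nat) (a : T) (A : {ffun 'I_n -> T}) :
  {ffun 'I_n.+1 -> T} := [ffun j => oapp A a (unlift ord0 j)].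

Lemma fcons0 (T : finType) (n : nat) (a : T) (A : {ffun 'I_n -> T}) :
  fcons a A ord0 = a.
Proof. by rewrite ffunE unlift_none. Qed.

Lemma fconsS (T : finType) (n : nat) (a : T) (A : {ffun 'I_n -> T}) (j : 'I_n) :
  fcons a A (lift ord0 j) = A j.
Proof. by rewrite ffunE liftK. Qed.

Lemma sum_fcons (R : nmodType) (T : finType) (n : nat)
    (F : {ffun 'I_n.+1 -> T} -> R) :
  \sum_A F A = \sum_a \sum_(A : {ffun 'I_n -> T}) F (fcons a A).
Proof.
rewrite pair_bigA /= (reindex (fun p : T * {ffun 'I_n -> T} => fcons p.1 p.2))//.
exists (fun A : {ffun 'I_n.+1 -> T} => (A ord0, [ffun j : 'I_n => A (lift ord0 j)]))
  => [[a A]|A] _ /=.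
  by rewrite fcons0; congr pair; apply/ffunP => j; rewrite ffunE fconsS.
apply/ffunP => j; case: (unliftP ord0 j) => [i|] ->; last by rewrite fcons0.
by rewrite fconsS ffunE.
Qed.

Definition row_of (I S : finType) (n : nat) (A : {ffun 'I_n -> {ffun I -> S}})
  (i : I) : {ffun 'I_n -> S} := [ffun j => A j i].

(* Bounds for forms with nonnegative coefficients tensorize: apply the induction
   hypothesis for fixed first column, then the one-column bound to the norms. *)
Lemma nonneg_form_tensor (R : rcfType) (I S : finType) (i1 : I)
    (K : {ffun I -> S} -> R) :
  (forall a, 0 <= K a) ->
  (forall g : I -> S -> R, (forall i s, 0 <= g i s) ->
    \sum_a K a * \prod_(i | i != i1) g i (a i) <=
    \prod_(i | i != i1) Num.sqrt (\sum_s g i s ^+ 2)) ->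
  forall (n : nat) (F : I -> {ffun 'I_n -> S} -> R), (forall i s, 0 <= F i s) ->
    \sum_(A : {ffun 'I_n -> {ffun I -> S}})
       (\prod_j K (A j)) * \prod_(i | i != i1) F i (row_of A i) <=
    \prod_(i | i != i1) Num.sqrt (\sum_s F i s ^+ 2).
Proof.
move=> K0 K1; elim=> [|n IH] F F0.
  (* With no columns every sum has a single term, and both sides are the same product. *)
  have sum_ffun0 (T : finType) (G : {ffun 'I_0 -> T} -> R) f : \sum_A G A = G f.
    have uf g : g = f by apply/ffunP => -[].
    by rewrite (bigD1 f)//= big1 ?addr0// => g /eqP[]; apply: uf.
  pose f0 (T : finType) := ffun0 (rT := fun=> T) (card_ord 0).
  rewrite (sum_ffun0 _ _ (f0 _)) big_ord0 mul1r.
  rewrite le_eqVlt; apply/predU1P; left; apply: eq_bigr => i _.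
  by rewrite (sum_ffun0 _ _ (row_of (f0 _) i)) sqrtr_sqr ger0_norm.
(* The norm of the slice of [F i] with first entry [s]; the squares of these norms add up to the
   squared norm of [F i]. *)
pose N i s := Num.sqrt (\sum_(t : {ffun 'I_n -> S}) F i (fcons s t) ^+ 2).
have row_fcons a (A : {ffun 'I_n -> {ffun I -> S}}) i :
    row_of (fcons a A) i = fcons (a i) (row_of A i).
  apply/ffunP => j; rewrite ffunE; case: (unliftP ord0 j) => [l|] ->.
    by rewrite !fconsS ffunE.
  by rewrite !fcons0.
rewrite sum_fcons; apply: (@le_trans _ _ (\sum_a K a * \prod_(i | i != i1) N i (a i))).
  apply: ler_sum => a _; apply: le_trans (ler_wpM2l (K0 a) (IH _ _)) => //.
  rewrite mulr_sumr le_eqVlt; apply/predU1P; left; apply: eq_bigr => A _.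
  rewrite big_ord_recl fcons0 -!mulrA; congr (_ * (_ * _)).
    by apply: eq_bigr => j _; rewrite fconsS.
  by apply: eq_bigr => i _; rewrite row_fcons.
apply: le_trans (K1 _ _) _ => [i s|]; first exact: sqrtr_ge0.
rewrite le_eqVlt; apply/predU1P; left; apply: eq_bigr => i _; congr Num.sqrt.
rewrite sum_fcons; apply: eq_bigr => s _; rewrite sqr_sqrtr// sumr_ge0// => t _.
exact: sqr_ge0.
Qed.

(** * Columns grouped by their support *)

Definition supp (I : finType) (q : nat) (a : {ffun I -> 'I_q}) : {set I} :=
  [set i | (a i : nat) != 0%N].

Definition set_coord (I S : finType) (a : {ffun I -> S}) (i1 : I) (s : S) :
  {ffun I -> S} := [ffun i => if i == i1 then s else a i].

(** Each fibre of the map forgetting coordinate [i1] has one representative with entry [s0] there,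
    and [G] is constant on it. This isolates the sum over the first index, to which Bessel's
    inequality applies. *)
Lemma sum_set_coord (R : pzSemiRingType) (I S : finType) (i1 : I) (s0 : S)
    (K G : {ffun I -> S} -> R) :
  (forall a s, G (set_coord a i1 s) = G a) ->
  \sum_a K a * G a =
  \sum_(b : {ffun I -> S} | b i1 == s0) (\sum_s K (set_coord b i1 s)) * G b.
Proof.
move=> G1.
rewrite (partition_big (fun a => set_coord a i1 s0) (fun b => b i1 == s0))/=; last first.
  by move=> a _; rewrite ffunE eqxx.
apply: eq_bigr => b /eqP b0; rewrite mulr_suml.
rewrite (reindex_onto (set_coord b i1) (fun a => a i1))/=; last first.
  move=> a /eqP <-; apply/ffunP => i; rewrite !ffunE.
  by case: eqP => // ->.
apply: eq_big => [s|s _]; last by rewrite G1.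
rewrite ffunE eqxx eqxx andbT; apply/eqP/ffunP => i; rewrite !ffunE.
by case: eqP => // ->.
Qed.

(** Both constraints on [b] are coordinatewise, so the sum of products is a product of sums. At [i1]
    they contradict each other exactly when [i1] lies in [P]. *)
Lemma sum_supp_eq (R : comPzSemiRingType) (I : finType) (i1 : I) (q : nat)
    (P : {set I}) (g : I -> 'I_q.+1 -> R) :
  \sum_(b : {ffun I -> 'I_q.+1} | (b i1 == ord0) && (supp b == P))
    \prod_(i | i != i1) g i (b i) =
  \prod_i (if i == i1 then (i \notin P)%:R
           else if i \in P then \sum_(s in [set s : 'I_q.+1 | (s : nat) != 0%N]) g i s
           else g i ord0).
Proof.
pose Q i (s : 'I_q.+1) := ((s != ord0) == (i \in P)) && ((i == i1) ==> (s == ord0)).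
transitivity (\prod_i \sum_(s | Q i s) (if i == i1 then 1 else g i s)).
  rewrite bigA_distr_big_dep; apply: eq_big => [b|b _]; last first.
    by rewrite big_mkcond /=; apply: eq_bigr => i _; case: eqP.
  apply/andP/familyP => [[/eqP b1 /eqP bP] i|bQ].
    rewrite -[_ \in _]/(Q i (b i)) /Q -bP inE eqxx /=.
    by apply/implyP => /eqP ->; apply/eqP.
  have bQ' i : Q i (b i) := bQ i.
  split; first by have := bQ' i1; rewrite /Q eqxx => /andP[].
  by apply/eqP/setP => i; rewrite inE; have /andP[/eqP] := bQ' i.
apply: eq_bigr => i _; rewrite /Q.
case: eqVneq => [->|_] /=.
  case: (i1 \in P) => /=; last first.
    by rewrite (big_pred1 ord0)// => s /=; case: (s == ord0).
  by rewrite big_pred0// => s; case: (s == ord0).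
case: (i \in P).
  by apply: eq_bigl => s; rewrite inE andbT; case: (eqVneq s ord0) => [->|].
by rewrite (big_pred1 ord0)// => s /=; rewrite andbT; case: (s == ord0).
Qed.

(** Here [q] counts the nontrivial characters. Summing over the entry at [i1] leaves [kappa];
    grouping the other entries by support [P], Cauchy-Schwarz costs [Num.sqrt q%:R] for each element
    of [P]. The weights [kappa] absorb this cost, and [pattern_ineq] concludes. *)
Lemma one_column (R : rcfType) (k q : nat) (i1 : 'I_k)
    (K : {ffun 'I_k -> 'I_q.+1} -> R) (kappa : nat -> R) :
  (forall r, 0 <= kappa r) ->
  (forall r, kappa r * Num.sqrt q%:R ^+ r <= pattern_weight R k r) ->
  (forall a : {ffun 'I_k -> 'I_q.+1}, a i1 = ord0 ->
    \sum_s K (set_coord a i1 s) <= kappa #|supp a|) ->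
  forall g : 'I_k -> 'I_q.+1 -> R, (forall i s, 0 <= g i s) ->
    \sum_a K a * \prod_(i | i != i1) g i (a i) <=
    \prod_(i | i != i1) Num.sqrt (\sum_s g i s ^+ 2).
Proof.
move=> kappa0 kappa_le K_le g g0.
pose nz := [set s : 'I_q.+1 | (s : nat) != 0%N].
have card_nz : #|nz| = q.
  transitivity #|[set~ ord0 : 'I_q.+1]|; last by rewrite cardsC1 card_ord.
  by apply: eq_card => s; rewrite !inE.
(* The values 0 and 1 at [i1] make its norm factor 1 and kill the patterns containing [i1]. *)
pose X i := if i == i1 then 0 else Num.sqrt (\sum_(s in nz) g i s ^+ 2).
pose Y i := if i == i1 then 1 else g i ord0.
have X0 i : 0 <= X i by rewrite /X; case: eqP => // _; apply: sqrtr_ge0.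
have Y0 i : 0 <= Y i by rewrite /Y; case: eqP.
have -> : \prod_(i | i != i1) Num.sqrt (\sum_s g i s ^+ 2) =
    \prod_i Num.sqrt (X i ^+ 2 + Y i ^+ 2).
  rewrite big_mkcond /=; apply: eq_bigr => i _; rewrite /X /Y.
  case: eqP => [_|_] /=; first by rewrite expr0n expr1n add0r sqrtr1.
  rewrite sqr_sqrtr ?sumr_ge0// => [|s _]; last exact: sqr_ge0.
  congr Num.sqrt; rewrite (bigD1 ord0)//= addrC; congr (_ + _).
  by apply: eq_bigl => s; rewrite inE.
have k0 : (0 < #|'I_k|)%N by apply/card_gt0P; exists i1.
apply: le_trans (pattern_ineq k0 X0 Y0); rewrite card_ord.
rewrite (sum_set_coord (i1 := i1) ord0) => [|a s]; last first.
  by apply: eq_bigr => i /negbTE ni; rewrite ffunE ni.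
rewrite (partition_big (@supp _ _) predT)//=; apply: ler_sum => P _.
pose t := Num.sqrt q%:R : R.
have t0 : 0 <= t by apply: sqrtr_ge0.
apply: (@le_trans _ _ (kappa #|P| *
    \prod_i (if i \in P then t * X i else Y i))).
  apply: (@le_trans _ _ (kappa #|P| * \sum_(b : {ffun 'I_k -> 'I_q.+1} |
      (b i1 == ord0) && (supp b == P)) \prod_(i | i != i1) g i (b i))).
    rewrite mulr_sumr; apply: ler_sum => b /andP[/eqP b1 /eqP <-].
    by apply: ler_wpM2r (K_le _ b1); apply: prodr_ge0.
  apply: ler_wpM2l => //; rewrite sum_supp_eq; apply: ler_prod => i _.
  rewrite /X /Y; case: eqP => _; case: ifP => _ //=; rewrite ?mulr0 ?lexx ?ler01 ?g0//=.
  by rewrite sumr_ge0//=; have := sum_le_sqrt nz (g i); rewrite card_nz.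
have -> : \prod_i (if i \in P then t * X i else Y i) =
    t ^+ #|P| * \prod_i (if i \in P then X i else Y i).
  rewrite -prodr_const [X in X * _]big_mkcond -big_split /=; apply: eq_bigr => i _.
  by case: ifP; rewrite ?mul1r.
rewrite mulrA; apply: ler_wpM2r (kappa_le _).
by apply: prodr_ge0 => i _; case: ifP.
Qed.

(** * Fourier analysis on a finite probability space *)

Lemma cabs_ge0 (R : realType) (z : R[i]) : 0 <= cabs z.
Proof. by case: z => a b; apply: sqrtr_ge0. Qed.

Lemma cabsM (R : realType) : {morph @cabs R : x y / x * y}.
Proof. exact: Normc.normcM. Qed.

Lemma cabs1 (R : realType) : cabs (1 : R[i]) = 1.
Proof. exact: Normc.normc1. Qed.

Lemma cabs0 (R : realType) : cabs (0 : R[i]) = 0.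
Proof. exact: Normc.normc0. Qed.

Lemma cabs_sqr (R : realType) (z : R[i]) : (cabs z ^+ 2)%:C = z * Num.conj z.
Proof. by rewrite -sqr_normc rmorphXn; case: z. Qed.

Lemma cabsJ (R : realType) (z : R[i]) : cabs (Num.conj z) = cabs z.
Proof. by case: z => a b; rewrite /cabs /= sqrrN. Qed.

Lemma conj_real_complex (R : realType) (x : R) : Num.conj (x%:C : R[i]) = x%:C.
Proof. exact: conjc_real. Qed.

Lemma cabs_ge0_real (R : realType) (x : R) : 0 <= x -> cabs x%:C = x.
Proof. by move=> x0; rewrite /cabs /= expr0n addr0 sqrtr_sqr ger0_norm. Qed.

Lemma cabs_sum (R : realType) (I : Type) (r : seq I) (P : pred I) (F : I -> R[i]) :
  cabs (\sum_(i <- r | P i) F i) <= \sum_(i <- r | P i) cabs (F i).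
Proof.
elim/big_rec2: _ => [|i x y _ h]; first by rewrite cabs0.
by apply: le_trans (le_normcD _ _) _; rewrite lerD2l.
Qed.

Lemma cabs_prod (R : realType) (I : Type) (r : seq I) (P : pred I) (F : I -> R[i]) :
  cabs (\prod_(i <- r | P i) F i) = \prod_(i <- r | P i) cabs (F i).
Proof.
by elim/big_rec2: _ => [|i x y _ <-]; [apply: cabs1|apply: cabsM].
Qed.

(** Orthonormality read on the other side: the matrix of entries [sqrt (w x) * chi s x] times its
    adjoint is the identity in both orders. Expansion, Parseval and pointwise bounds follow from
    this relation, which is stable under products. *)
Definition complete_system (R : realType) (S T : finType) (w : T -> R)
  (chi : S -> T -> R[i]) : Prop :=
  forall x y, (w y)%:C * (\sum_s chi s x * Num.conj (chi s y)) = (x == y)%:R.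

(** Expand the indicator of [y] in the basis: its coefficients are
    [(w y)%:C * Num.conj (chi t y)]. *)
Lemma fourier_basis_complete (R : realType) (q : nat) (T : finType) (w : T -> R)
    (chi : 'I_q -> T -> R[i]) :
  fourier_basis w chi -> complete_system w chi.
Proof.
case=> _ ortho span x y.
have [c cE] := span (fun x => (x == y)%:R).
suff c_coef t : c t = (w y)%:C * Num.conj (chi t y).
  rewrite cE mulr_sumr; apply: eq_bigr => s _; rewrite c_coef; ring.
transitivity (inner w (fun x => (x == y)%:R) (chi t)).
  rewrite /inner /expect; under eq_bigr => z _.
    rewrite cE mulr_suml mulr_sumr.
    under eq_bigr => s _ do rewrite -mulrA mulrCA.
    over.
  rewrite exchange_big /= (bigD1 t)//= -mulr_sumr.
  have /eqP := ortho t t; rewrite eqxx /inner /expect => /eqP ->.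
  rewrite mulr1 big1 ?addr0// => s st; rewrite -mulr_sumr.
  by have := ortho s t; rewrite (negbTE st) /inner /expect => ->; rewrite mulr0.
rewrite /inner /expect (bigD1 y)//= eqxx mul1r big1 ?addr0// => z /negbTE ->.
by rewrite mul0r mulr0.
Qed.

Lemma complete_prod (R : realType) (q n : nat) (T : finType) (w : T -> R)
    (chi : 'I_q -> T -> R[i]) :
  complete_system w chi ->
  complete_system (prod_distr w) (@fourier_char R q n T chi).
Proof.
move=> cchi x y; rewrite /prod_distr /fourier_char.
transitivity (\prod_j ((w (y j))%:C * \sum_s chi s (x j) * Num.conj (chi s (y j)))).
  rewrite big_split /= rmorph_prod bigA_distr_bigA; congr (_ * _).
  by apply: eq_bigr => s _; rewrite rmorph_prod -big_split.
under eq_bigr do rewrite cchi.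
case: eqVneq => [->|/eqP xy]; first by apply: big1 => j _; rewrite eqxx.
have [j xyj] : exists j, x j != y j.
  apply/existsP; apply: contra_notT xy; rewrite negb_exists => /forallP xy.
  by apply/ffunP => j; apply/eqP; have := xy j; rewrite negbK.
by rewrite (bigD1 j)//= (negbTE xyj) mul0r.
Qed.

Lemma complete_diag (R : realType) (S T : finType) (w : T -> R)
    (chi : S -> T -> R[i]) (x : T) :
  complete_system w chi -> (w x)%:C * (\sum_s chi s x * Num.conj (chi s x)) = 1.
Proof. by move=> ->; rewrite eqxx. Qed.

Lemma complete_expand (R : realType) (S T : finType) (w : T -> R)
    (chi : S -> T -> R[i]) (f : T -> R[i]) (x : T) :
  complete_system w chi -> f x = \sum_s inner w f (chi s) * chi s x.
Proof.
move=> cchi; rewrite /inner /expect; under eq_bigr do rewrite mulr_suml.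
rewrite exchange_big /= (bigD1 x)//= [X in _ + X]big1 => [|y yx].
  rewrite addr0 -[LHS]mulr1 -(complete_diag x cchi).
  by rewrite !mulr_sumr; apply: eq_bigr => s _; ring.
transitivity (f y * (x == y)%:R).
  by rewrite -cchi !mulr_sumr; apply: eq_bigr => s _; ring.
by rewrite eq_sym (negbTE yx) mulr0.
Qed.

Lemma complete_parseval (R : realType) (S T : finType) (w : T -> R)
    (chi : S -> T -> R[i]) (f : T -> R[i]) :
  complete_system w chi ->
  \sum_s cabs (inner w f (chi s)) ^+ 2 = \sum_x w x * cabs (f x) ^+ 2.
Proof.
move=> cchi; apply: (@complexI R); rewrite !rmorph_sum /=.
under eq_bigr => s _.
  rewrite cabs_sqr [X in _ * Num.conj X]/inner /expect rmorph_sum mulr_sumr.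
  under eq_bigr => x _ do
    rewrite !rmorphM /= conj_real_complex conjCK mulrCA [X in _ * X]mulrCA.
  over.
rewrite exchange_big /=; apply: eq_bigr => x _.
rewrite rmorphM /= cabs_sqr -mulr_sumr; congr (_ * _).
rewrite {2}(complete_expand f x cchi) mulrC mulr_sumr.
by apply: eq_bigr.
Qed.

(** On the diagonal, completeness says that [w x] times the sum of all [cabs (chi s x) ^+ 2] is 1;
    one term is at most the sum. *)
Lemma complete_bound (R : realType) (S T : finType) (w : T -> R)
    (chi : S -> T -> R[i]) (s : S) (x : T) :
  complete_system w chi -> 0 < w x -> cabs (chi s x) ^+ 2 <= (w x)^-1.
Proof.
move=> cchi w0; rewrite -[leRHS]mul1r ler_pdivlMr// mulrC.
have <- : w x * \sum_s cabs (chi s x) ^+ 2 = 1.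
  apply: (@complexI R); rewrite rmorphM rmorph_sum /= rmorph1.
  rewrite -(complete_diag x cchi); congr (_ * _).
  by apply: eq_bigr => t _; rewrite cabs_sqr.
apply: ler_wpM2l; first exact: ltW.
rewrite (bigD1 s)//= lerDl sumr_ge0// => t _.
exact: sqr_ge0.
Qed.

(** * Moments of characters *)

Definition moment (R : realType) (k q : nat) (Omega : 'I_k -> finType)
  (mu : {dffun forall i : 'I_k, Omega i} -> R)
  (chi : forall i : 'I_k, 'I_q -> Omega i -> R[i]) (a : {ffun 'I_k -> 'I_q}) :
  R[i] := expect mu (fun x => \prod_i chi i (a i) (x i)).

Lemma sum_row_of (V : nmodType) (I S : finType) (n : nat)
    (F : {ffun I -> {ffun 'I_n -> S}} -> V) :
  \sum_B F B = \sum_(A : {ffun 'I_n -> {ffun I -> S}}) F [ffun i => row_of A i].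
Proof.
apply: (reindex (fun A : {ffun 'I_n -> {ffun I -> S}} => [ffun i => row_of A i])).
exists (fun B : {ffun I -> {ffun 'I_n -> S}} => [ffun j => [ffun i => B i j]]).
  by move=> A _; apply/ffunP => j; apply/ffunP => i; rewrite !ffunE.
by move=> B _; apply/ffunP => j; apply/ffunP => i; rewrite !ffunE.
Qed.

(** After expansion of every [f i], the families of multi-indices are transposed into columns; since
    the columns of [X] are independent, the expectation factors into one moment per column. *)
Lemma noisy_expand (R : realType) (k q n : nat) (Omega : 'I_k -> finType)
    (mu : {dffun forall i : 'I_k, Omega i} -> R)
    (chi : forall i : 'I_k, 'I_q -> Omega i -> R[i])
    (f : forall i : 'I_k, {ffun 'I_n -> Omega i} -> R[i]) :
  (forall i, complete_system (marginal mu (i := i)) (chi i)) ->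
  noisy_inner mu f =
  \sum_(A : {ffun 'I_n -> {ffun 'I_k -> 'I_q}}) (\prod_j moment mu chi (A j)) *
    \prod_i fourier_coef (marginal mu (i := i)) (chi i) (f i) (row_of A i).
Proof.
move=> cchi; rewrite /noisy_inner {1}/expect.
pose fc i := fourier_coef (marginal mu (i := i)) (chi i) (f i).
have fE i x : f i x = \sum_s fc i s * fourier_char (chi i) s x.
  by rewrite (complete_expand (f i) x (complete_prod (n := n) (cchi i))).
under eq_bigr => X _.
  under [X in _ * X]eq_bigr => i _ do rewrite fE.
  rewrite bigA_distr_bigA mulr_sumr; over.
rewrite exchange_big /= sum_row_of; apply: eq_bigr => A _.
under eq_bigr => X _ do rewrite big_split /= mulrCA.
rewrite -mulr_sumr mulrC; congr (_ * _); last first.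
  by apply: eq_bigr => i _; rewrite ffunE.
rewrite /moment /expect bigA_distr_bigA; apply: eq_bigr => X _.
rewrite big_split /= rmorph_prod; congr (_ * _).
rewrite exchange_big /=; apply: eq_bigr => i _.
by apply: eq_bigr => j _; rewrite !ffunE.
Qed.

Lemma expect_pair (R : realType) (k : nat) (Omega : 'I_k -> finType)
    (mu : {dffun forall i : 'I_k, Omega i} -> R) (i j : 'I_k)
    (u : Omega i -> R[i]) (v : Omega j -> R[i]) :
  pairwise_independent mu -> i != j ->
  expect mu (fun x => u (x i) * v (x j)) =
  expect (marginal mu (i := i)) u * expect (marginal mu (i := j)) v.
Proof.
(* Pairwise independence is stated for [i < j] only; the other order follows by commutativity. *)
move=> pw; wlog ij : i j u v / (i < j)%N => [IH ne|_].
  case: (ltngtP i j) => [|ji|/ord_inj e]; last by rewrite e eqxx in ne.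
    by move=> ij; apply: IH.
  rewrite mulrC -IH// 1?eq_sym//.
  by apply: eq_bigr => x _; rewrite [u _ * _]mulrC.
rewrite /expect (partition_big (fun x : {dffun forall i, Omega i} => x i) predT)//=.
rewrite mulr_suml; apply: eq_bigr => a _.
rewrite (partition_big (fun x : {dffun forall i, Omega i} => x j) predT)//=.
rewrite mulr_sumr; apply: eq_bigr => b _.
transitivity ((\sum_(x : {dffun forall l : 'I_k, Omega l} | (x i == a) && (x j == b))
    mu x)%:C * (u a * v b)).
  by rewrite rmorph_sum mulr_suml; apply: eq_bigr => x /andP[/eqP -> /eqP ->].
by rewrite pw// rmorphM /=; ring.
Qed.

Lemma marginal_distr (R : realType) (k : nat) (Omega : 'I_k -> finType)
    (mu : {dffun forall i : 'I_k, Omega i} -> R) (i : 'I_k) :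
  is_distr mu -> is_distr (marginal mu (i := i)).
Proof.
case=> mu0 mu1; split => [a|]; first exact: sumr_ge0.
by rewrite -mu1 [RHS](partition_big (fun x : {dffun forall i, Omega i} => x i) predT).
Qed.

Lemma fourier_basis_mean (R : realType) (q : nat) (T : finType) (w : T -> R)
    (chi : 'I_q.+1 -> T -> R[i]) (s : 'I_q.+1) :
  fourier_basis w chi -> s != ord0 -> expect w (chi s) = 0.
Proof.
case=> chi0 ortho _ s0; transitivity (inner w (chi s) (chi ord0)).
  by apply: eq_bigr => x _; rewrite [chi ord0 x]chi0// rmorph1 mulr1.
by rewrite ortho (negbTE s0).
Qed.

Lemma moment_supp0 (R : realType) (k q : nat) (Omega : 'I_k -> finType)
    (mu : {dffun forall i : 'I_k, Omega i} -> R)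
    (chi : forall i : 'I_k, 'I_q.+1 -> Omega i -> R[i])
    (a : {ffun 'I_k -> 'I_q.+1}) :
  is_distr mu -> (forall i, fourier_basis (marginal mu (i := i)) (chi i)) ->
  #|supp a| = 0%N -> moment mu chi a = 1.
Proof.
move=> [_ mu1] fb /eqP; rewrite cards_eq0 => /eqP a0.
have chi0 i x : chi i (a i) x = 1.
  have [h _ _] := fb i; apply: h; apply/eqP.
  by have /setP/(_ i) := a0; rewrite !inE => /negbFE.
transitivity ((\sum_x mu x)%:C : R[i]); last by rewrite mu1.
by rewrite rmorph_sum; apply: eq_bigr => x _; rewrite big1 ?mulr1.
Qed.

(** The support lies in a pair of indices, where a singleton is completed by any other index,
    available as [k] is at least 2. The expectation then factors, and a nontrivial character has
    mean 0. *)
Lemma moment_supp12 (R : realType) (k q : nat) (Omega : 'I_k -> finType)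
    (mu : {dffun forall i : 'I_k, Omega i} -> R)
    (chi : forall i : 'I_k, 'I_q.+1 -> Omega i -> R[i])
    (a : {ffun 'I_k -> 'I_q.+1}) :
  (1 < k)%N -> pairwise_independent mu ->
  (forall i, fourier_basis (marginal mu (i := i)) (chi i)) ->
  (0 < #|supp a| <= 2)%N -> moment mu chi a = 0.
Proof.
move=> k2 pw fb /andP[/card_gt0P[i ia] a2].
have [j ij sub] : exists2 j, i != j & supp a \subset [set i; j].
  have [/eqP e|[j]] := set_0Vmem (supp a :\ i).
    have : (0 < #|[set~ i]|)%N.
      by rewrite cardsC1 card_ord; case: k k2 {mu chi a pw fb a2 i ia e Omega} => [|[]].
    case/card_gt0P => j; rewrite !inE => ji; exists j; first by rewrite eq_sym.
    by rewrite -(finset.setD1K ia) (eqP e) finset.setU0 finset.sub1set !inE eqxx.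
  rewrite !inE => /andP[ji ja]; exists j; first by rewrite eq_sym.
  suff /eqP <- : [set i; j] == supp a by [].
  rewrite eqEcard cards2 eq_sym ji a2 andbT finset.subUset !finset.sub1set ia.
  by rewrite inE.
transitivity (expect mu (fun x => chi i (a i) (x i) * chi j (a j) (x j))).
  apply: eq_bigr => x _; congr (_ * _).
  rewrite (bigD1 i)//= (bigD1 j) 1?eq_sym//= big1 ?mulr1// => l /andP[li lj].
  have [h _ _] := fb l; apply: h; apply/eqP; apply: contraTT isT => al.
  have /(fintype.subsetP sub) : l \in supp a by rewrite inE.
  by rewrite !inE (negbTE li) (negbTE lj).
rewrite (expect_pair (chi i (a i)) (chi j (a j)) pw ij).
by rewrite fourier_basis_mean ?mul0r//; move: ia; rewrite inE.
Qed.

Lemma cabs_wsum (R : realType) (T : finType) (P : pred T) (w : T -> R)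
    (f : T -> R[i]) (B : R) :
  (forall x, 0 <= w x) -> (forall x, cabs (f x) <= B) ->
  cabs (\sum_(x | P x) (w x)%:C * f x) <= (\sum_(x | P x) w x) * B.
Proof.
move=> w0 fB; apply: le_trans (cabs_sum _ _ _) _.
rewrite mulr_suml; apply: ler_sum => x _.
by rewrite cabsM cabs_ge0_real// ler_wpM2l.
Qed.

Lemma cabs_char_prod (R : realType) (k q : nat) (Omega : 'I_k -> finType)
    (chi : forall i : 'I_k, 'I_q.+1 -> Omega i -> R[i]) (M : R)
    (a : {ffun 'I_k -> 'I_q.+1}) (x : {dffun forall i : 'I_k, Omega i}) :
  (forall i y, chi i ord0 y = 1) -> (forall i s y, cabs (chi i s y) <= M) ->
  cabs (\prod_i chi i (a i) (x i)) <= M ^+ #|supp a|.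
Proof.
move=> chi0 chiM; rewrite cabs_prod -prodr_const [leRHS]big_mkcond /=.
apply: ler_prod => i _; rewrite cabs_ge0 inE; case: eqVneq => //= ai0.
by rewrite (_ : a i = ord0) ?chi0 ?cabs1//; apply: val_inj.
Qed.

Lemma moment_le (R : realType) (k q : nat) (Omega : 'I_k -> finType)
    (mu : {dffun forall i : 'I_k, Omega i} -> R)
    (chi : forall i : 'I_k, 'I_q.+1 -> Omega i -> R[i]) (M : R)
    (a : {ffun 'I_k -> 'I_q.+1}) :
  is_distr mu ->
  (forall i y, chi i ord0 y = 1) -> (forall i s y, cabs (chi i s y) <= M) ->
  cabs (moment mu chi a) <= M ^+ #|supp a|.
Proof.
move=> [mu0 mu1] chi0 chiM; rewrite -[leRHS]mul1r -mu1.
by apply: cabs_wsum => // x; apply: cabs_char_prod.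
Qed.

(* Bessel's inequality for the expectation of the other characters conditioned on
   the coordinate [i1]; it saves a factor [sqrt q] over the trivial bound. *)
Lemma moment_bessel (R : realType) (k q : nat) (Omega : 'I_k -> finType)
    (mu : {dffun forall i : 'I_k, Omega i} -> R)
    (chi : forall i : 'I_k, 'I_q.+1 -> Omega i -> R[i]) (M : R) (i1 : 'I_k)
    (a : {ffun 'I_k -> 'I_q.+1}) :
  is_distr mu -> (forall u : Omega i1, 0 < marginal mu u) ->
  complete_system (marginal mu (i := i1)) (chi i1) ->
  (forall i y, chi i ord0 y = 1) -> (forall i s y, cabs (chi i s y) <= M) ->
  0 <= M -> a i1 = ord0 ->
  \sum_(s in [set s : 'I_q.+1 | (s : nat) != 0%N])
    cabs (moment mu chi (set_coord a i1 s)) <= Num.sqrt q%:R * M ^+ #|supp a|.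
Proof.
move=> mud m0 cchi chi0 chiM M0 a1; have [mu0 mu1] := mud.
set nz := [set s : 'I_q.+1 | _].
have card_nz : #|nz| = q.
  transitivity #|[set~ ord0 : 'I_q.+1]|; last by rewrite cardsC1 card_ord.
  by apply: eq_card => s; rewrite !inE.
pose G (x : {dffun forall i : 'I_k, Omega i}) := \prod_i chi i (a i) (x i).
pose B := M ^+ #|supp a|.
have B0 : 0 <= B by apply: exprn_ge0.
pose H (u : Omega i1) := \sum_(x : {dffun forall i : 'I_k, Omega i} | x i1 == u)
  (mu x)%:C * G x.
have HB u : cabs (H u) <= marginal mu u * B.
  by apply: cabs_wsum => // x; apply: cabs_char_prod.
(* The conjugate of the conditional expectation of [G] given [x i1 = u]. Its Fourier coefficients
   are the conjugated moments, and it is bounded by [B]. *)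
pose h (u : Omega i1) := Num.conj (H u) * ((marginal mu u)^-1)%:C.
have momentE s : cabs (moment mu chi (set_coord a i1 s)) =
    cabs (inner (marginal mu (i := i1)) h (chi i1 s)).
  rewrite -cabsJ; congr cabs.
  rewrite /inner /expect /moment /expect.
  rewrite (partition_big (fun x : {dffun forall i, Omega i} => x i1) predT)//=.
  rewrite rmorph_sum; apply: eq_bigr => u _.
  transitivity (Num.conj (H u * chi i1 s u)).
    congr Num.conj; rewrite mulr_suml; apply: eq_bigr => x /eqP xu.
    rewrite -mulrA; congr (_ * _); rewrite /G (bigD1 i1)//= [in RHS](bigD1 i1)//=.
    rewrite a1 chi0 mul1r ffunE eqxx xu mulrC; congr (_ * _).
    by apply: eq_bigr => i /negbTE ii1; rewrite ffunE ii1.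
  rewrite rmorphM /= /h -mulrA mulrCA; congr (_ * _).
  by rewrite mulrA -rmorphM /= divff ?gt_eqF// mul1r.
under eq_bigr do rewrite momentE.
have := sum_le_sqrt nz (fun s => cabs (inner (marginal mu (i := i1)) h (chi i1 s))).
rewrite card_nz => /le_trans; apply; apply: ler_wpM2l; first exact: sqrtr_ge0.
rewrite -[leRHS]ger0_norm// -sqrtr_sqr ler_wsqrtr//.
apply: (@le_trans _ _
    (\sum_s cabs (inner (marginal mu (i := i1)) h (chi i1 s)) ^+ 2)).
  by rewrite [leRHS](bigID (mem nz))/= lerDl sumr_ge0// => s _; apply: sqr_ge0.
rewrite (complete_parseval h cchi) -[leRHS]mul1r.
have [_ <-] := marginal_distr i1 mud; rewrite mulr_suml; apply: ler_sum => u _.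
apply: ler_wpM2l; first exact: ltW.
rewrite ler_pXn2r ?nnegrE ?cabs_ge0//.
rewrite cabsM cabsJ cabs_ge0_real; last by rewrite invr_ge0 ltW.
by rewrite ler_pdivrMr// mulrC.
Qed.

(* [t] stands for the paper's [sqrt (q - 1)] and [M] for a bound on the
   characters; [c] is the price of a nontrivial entry. *)
Definition column_weight (R : realFieldType) (t M c : R) (r : nat) : R :=
  match r with
  | 0 => 1
  | 1 => 0
  | 2 => t * M ^+ 2 / c ^+ 3
  | _ => (1 + t / c) * (M / c) ^+ r
  end.

Lemma column_weight_ge0 (R : realFieldType) (t M c : R) (r : nat) :
  0 <= t -> 0 <= M -> 0 < c -> 0 <= column_weight t M c r.
Proof.
move=> t0 M0 c0; have c1 := ltW c0.
case: r => [|[|[|r]]] //=; first by rewrite !mulr_ge0 ?invr_ge0 ?exprn_ge0.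
by rewrite mulr_ge0 ?addr_ge0 ?exprn_ge0 ?divr_ge0.
Qed.

(** The choice of [c] gives [t * M / c <= 1 / k], hence also [t / c <= 1 / k] as [M >= 1]; the left
    side is a product of such factors. *)
Lemma column_weight_le (R : realFieldType) (k : nat) (t M c : R) (r : nat) :
  (0 < k)%N -> 0 <= t -> 1 <= M -> 0 < c -> k%:R * t * M <= c ->
  column_weight t M c r * t ^+ r <= pattern_weight R k r.
Proof.
move=> k0 t0 M1 c0 kc; have M0 : 0 <= M by apply: le_trans M1.
have kR : 0 < k%:R :> R by rewrite ltr0n.
have c1 := ltW c0.
have h1 : t * M / c <= k%:R^-1.
  by rewrite ler_pdivrMr// [_^-1 * c]mulrC ler_pdivlMr// mulrC mulrA.
have h2 : t / c <= k%:R^-1.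
  by apply: le_trans h1; rewrite ler_wpM2r ?invr_ge0// ler_peMr.
have tM0 : 0 <= t * M / c by rewrite divr_ge0 ?mulr_ge0.
have tc0 : 0 <= t / c by rewrite divr_ge0.
case: r => [|[|[|r]]] /=; rewrite ?mul0r ?mulr1//.
  have -> : t * M ^+ 2 / c ^+ 3 * t ^+ 2 = t / c * (t * M / c) ^+ 2.
    by field; rewrite gt_eqF.
  rewrite [leRHS]exprS; apply: ler_pM => //; first exact: exprn_ge0.
  by rewrite ler_pXn2r ?nnegrE// invr_ge0 ltW.
rewrite -mulrA -exprMn; apply: ler_pM.
- by rewrite addr_ge0.
- by rewrite exprn_ge0// mulr_ge0// divr_ge0.
- by rewrite lerD2l.
- rewrite (_ : M / c * t = t * M / c); last by ring.
  by rewrite ler_pXn2r ?nnegrE ?invr_ge0//; apply: ltW.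
Qed.

Lemma card_supp_set_coord (I : finType) (q : nat) (a : {ffun I -> 'I_q.+1}) (i1 : I)
    (s : 'I_q.+1) :
  a i1 = ord0 -> (s : nat) != 0%N -> #|supp (set_coord a i1 s)| = #|supp a|.+1.
Proof.
move=> a1 s0; have -> : supp (set_coord a i1 s) = i1 |: supp a.
  by apply/setP => i; rewrite !inE ffunE; case: (i =P i1) => //; rewrite s0.
by rewrite cardsU1 inE a1 eqxx.
Qed.

(** Split off [s = ord0], and let [r] be the size of [supp a]. The trivial entry gives a moment on
    [r] coordinates and the others give moments on [r + 1], controlled by Bessel. Moments on one or
    two coordinates vanish, so for [r = 0] only the trivial entry survives, for [r = 1] nothing, for
    [r = 2] only the Bessel part, and from 3 on both. *)
Lemma moment_column (R : realType) (k q : nat) (Omega : 'I_k -> finType)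
    (mu : {dffun forall i : 'I_k, Omega i} -> R)
    (chi : forall i : 'I_k, 'I_q.+1 -> Omega i -> R[i]) (M c : R) (i1 : 'I_k)
    (a : {ffun 'I_k -> 'I_q.+1}) :
  (1 < k)%N -> is_distr mu -> pairwise_independent mu ->
  (forall (i : 'I_k) (u : Omega i), 0 < marginal mu u) ->
  (forall i, fourier_basis (marginal mu (i := i)) (chi i)) ->
  (forall i s y, cabs (chi i s y) <= M) -> 0 <= M -> 0 < c -> a i1 = ord0 ->
  \sum_s cabs (moment mu chi (set_coord a i1 s)) * c^-1 ^+ #|supp (set_coord a i1 s)|
    <= column_weight (Num.sqrt q%:R) M c #|supp a|.
Proof.
move=> k2 mud pw m0 fb chiM M0 c0 a1.
have chi0 i y : chi i ord0 y = 1 by have [h _ _] := fb i; apply: h.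
have ci0 : 0 <= c^-1 by rewrite invr_ge0 ltW.
rewrite (bigD1 ord0)//=.
have -> : set_coord a i1 ord0 = a.
  by apply/ffunP => i; rewrite ffunE; case: eqP => // ->.
have -> : \sum_(s | s != ord0) cabs (moment mu chi (set_coord a i1 s)) *
      c^-1 ^+ #|supp (set_coord a i1 s)| =
    (\sum_(s in [set s : 'I_q.+1 | (s : nat) != 0%N])
      cabs (moment mu chi (set_coord a i1 s))) * c^-1 ^+ #|supp a|.+1.
  rewrite mulr_suml; apply: eq_big => [s|s s0]; first by rewrite inE.
  by rewrite card_supp_set_coord.
have bessel := moment_bessel mud (m0 i1) (fourier_basis_complete (fb i1)) chi0 chiM M0 a1.
have le_a := moment_le a mud chi0 chiM.
have small : (0 < #|supp a| <= 2)%N -> cabs (moment mu chi a) = 0.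
  by move=> h; rewrite moment_supp12 ?cabs0.
have small1 : (#|supp a| <= 1)%N -> \sum_(s in [set s : 'I_q.+1 | (s : nat) != 0%N])
      cabs (moment mu chi (set_coord a i1 s)) = 0.
  move=> h; apply: big1 => s; rewrite inE => s0.
  by rewrite moment_supp12 ?cabs0// card_supp_set_coord.
have zero : #|supp a| = 0%N -> cabs (moment mu chi a) = 1.
  by move=> h; rewrite moment_supp0 ?cabs1.
move: (\sum_(s in _) _) (cabs (moment mu chi a)) bessel le_a small small1 zero => S T.
case: #|supp a| => [|[|[|r]]] bessel le_a small small1 zero /=.
- by rewrite small1// zero// mul0r addr0 mulr1.
- by rewrite small1// small// !mul0r addr0.
- by rewrite small// mul0r add0r -exprVn ler_wpM2r// exprn_ge0.
- have -> : (1 + Num.sqrt q%:R / c) * (M / c) ^+ r.+3 =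
      M ^+ r.+3 * c^-1 ^+ r.+3 + Num.sqrt q%:R * M ^+ r.+3 * c^-1 ^+ r.+4.
    by rewrite exprMn [c^-1 ^+ r.+4]exprS; ring.
  by apply: lerD; apply: ler_wpM2r => //; apply: exprn_ge0.
Qed.

(** * Fourier bases for uniform marginals *)

(** As [n] is invertible, ['X^n - 1] is separable and has [n] distinct roots, one of which must be
    primitive. *)
Lemma prim_root_exists (F : closedFieldType) (n : nat) :
  n%:R != 0 :> F -> exists z : F, n.-primitive_root z.
Proof.
move=> nF; have n0 : (0 < n)%N by case: n nF => //; rewrite eqxx.
have [r Dp] := closed_field_poly_normal ('X^n - 1 : {poly F}).
rewrite (monicP _) ?monicXnsubC// scale1r in Dp.
have rn1 : all n.-unity_root r by apply/allP => z; rewrite -root_prod_XsubC -Dp.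
have sz_r : (n < (size r).+1)%N.
  by rewrite -(size_prod_XsubC r id) -Dp size_XnsubC.
have [|z _ pz] := hasP (has_prim_root n0 rn1 _ sz_r); last by exists z.
by rewrite -separable_prod_XsubC -Dp separable_Xn_sub_1.
Qed.

(** A geometric sum with ratio [y = z ^+ i / z ^+ j], which is a [q]-th root of unity and equals 1
    only for [i = j]. *)
Lemma sum_prim_root_expr (F : fieldType) (q : nat) (z : F) (i j : nat) :
  (0 < q)%N -> q.-primitive_root z -> (i < q)%N -> (j < q)%N ->
  \sum_(s < q) z ^+ (s * i) * z ^- (s * j) = (i == j)%:R * q%:R.
Proof.
move=> q0 pz iq jq; have z0 : z != 0 by rewrite (prim_root_eq0 pz) gtn_eqF.
pose y := z ^+ i / z ^+ j.
have -> : \sum_(s < q) z ^+ (s * i) * z ^- (s * j) = \sum_(s < q) y ^+ s.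
  by apply: eq_bigr => s _; rewrite exprMn exprVn -!exprM ![(s * _)%N]mulnC.
have y1 : (y == 1) = (i == j).
  rewrite /y -(inj_eq (mulIf (expf_neq0 j z0))) mul1r divfK ?expf_neq0//.
  by rewrite (eq_prim_root_expr pz) !modn_small.
case: (eqVneq i j) y1 => [_ /eqP -> | _ /negbT y1].
  by under eq_bigr do rewrite expr1n; rewrite sumr_const card_ord mul1r.
rewrite mul0r; apply: (mulfI (_ : y - 1 != 0)); first by rewrite subr_eq0.
rewrite -subrX1 mulr0 /y exprMn exprVn -!exprM ![(_ * q)%N]mulnC !exprM.
by rewrite (prim_expr_order pz) !expr1n divr1 subrr.
Qed.

(** Numbering [T] turns it into a cyclic group, whose characters are powers of a primitive root of
    unity. *)
Lemma uniform_fourier_basis (R : realType) (q : nat) (T : finType) (w : T -> R) :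
  #|T| = q.+1 -> (forall x, w x = q.+1%:R^-1) ->
  exists2 chi : 'I_q.+1 -> T -> R[i], fourier_basis w chi &
    forall s x, cabs (chi s x) = 1.
Proof.
move=> cT wE; have q0 : q.+1%:R != 0 :> R[i] by rewrite pnatr_eq0.
have [z pz] := prim_root_exists q0.
pose rk x : 'I_q.+1 := cast_ord cT (enum_rank x).
pose chi (s : 'I_q.+1) x : R[i] := z ^+ (s * rk x).
have cz : cabs z = 1.
  have := congr1 (@cabs R) (prim_expr_order pz).
  rewrite cabs1 => h; apply/eqP; rewrite -(@pexpr_eq1 _ _ q.+1) ?cabs_ge0//.
  by apply/eqP; rewrite -h; elim: q.+1 => [|m IH]; rewrite ?cabs1// !exprS cabsM IH.
have cchi s x : cabs (chi s x) = 1.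
  by rewrite /chi; elim: (_ * _)%N => [|m IH]; rewrite ?cabs1// exprS cabsM cz IH mul1r.
have conjE s x : Num.conj (chi s x) = (chi s x)^-1.
  have n0 : chi s x != 0.
    by apply/eqP => h; have := cchi s x; rewrite h cabs0 => /esym/eqP; rewrite oner_eq0.
  apply: (mulfI n0); rewrite divff// -cabs_sqr cchi expr1n; exact: rmorph1.
have sumT (F : 'I_q.+1 -> R[i]) : \sum_x F (rk x) = \sum_i F i.
  rewrite (reindex (fun i => enum_val (cast_ord (esym cT) i)))/=.
    by apply: eq_bigr => i _; rewrite /rk enum_valK cast_ordKV.
  exists rk => [i _|x _]; first by rewrite /rk enum_valK cast_ordKV.
  by rewrite /rk cast_ordK enum_rankK.
have wC x : (w x)%:C = q.+1%:R^-1 :> R[i] by rewrite wE fmorphV rmorph_nat.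
exists chi => //; split.
- by move=> s s0 x; rewrite /chi s0 mul0n expr0.
- move=> s t; rewrite /inner /expect.
  transitivity (q.+1%:R^-1 * \sum_(i < q.+1) z ^+ (i * s) * z ^- (i * t) : R[i]).
    rewrite -(sumT (fun i => z ^+ (i * s) * z ^- (i * t))) mulr_sumr.
    by apply: eq_bigr => x _; rewrite wC conjE /chi ![(rk x * _)%N]mulnC.
  by rewrite (sum_prim_root_expr _ pz)// mulrCA mulVf// mulr1.
- move=> g; exists (fun s => inner w g (chi s)) => x.
  rewrite /inner /expect; under eq_bigr do rewrite mulr_suml.
  rewrite exchange_big /=.
  transitivity (\sum_y g y * (x == y)%:R).
    rewrite (bigD1 x)//= eqxx mulr1 big1 ?addr0// => y yx.
    by rewrite eq_sym (negbTE yx) mulr0.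
  apply: eq_bigr => y _.
  have rk_inj : (rk x == rk y :> nat) = (x == y).
    by rewrite /rk /= (inj_eq val_inj) (inj_eq enum_rank_inj).
  (* The exponent [s * rk x] is symmetric in [s] and [rk x], so the sum that gave orthogonality also
     gives completeness. *)
  transitivity (q.+1%:R^-1 * g y *
    \sum_(s < q.+1) z ^+ (s * rk x) * z ^- (s * rk y)).
    by rewrite (sum_prim_root_expr _ pz)// rk_inj; field.
  rewrite mulr_sumr; apply: eq_bigr => s _.
  by rewrite wC conjE /chi; ring.
Qed.

(** * Degrees *)

(** The Fourier degree as a natural number, with 0 in place of -oo when all coefficients vanish. *)
Definition fourier_width (R : realType) (q n : nat) (T : finType) (w : T -> R)
    (chi : 'I_q -> T -> R[i]) (f : {ffun 'I_n -> T} -> R[i]) : nat :=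
  \max_(sigma : {ffun 'I_n -> 'I_q} | fourier_coef w chi f sigma != 0) weight sigma.

Lemma fourier_degreeE (R : realType) (q n : nat) (T : finType) (w : T -> R)
    (chi : 'I_q -> T -> R[i]) (f : {ffun 'I_n -> T} -> R[i])
    (sigma : {ffun 'I_n -> 'I_q}) :
  fourier_coef w chi f sigma != 0 ->
  fourier_degree w chi f = ((fourier_width w chi f)%:R)%:E.
Proof.
move=> f0; apply/eqP; rewrite eq_le; apply/andP; split.
  apply: ereal_inf_lbound; exists (fourier_width w chi f)%:Z => //= tau.
  rewrite ltz_nat => lt_tau; apply/eqP; apply: contraTT lt_tau => ft.
  by rewrite -leqNgt leq_bigmax_cond.
apply: le_ereal_inf_tmp => _ [d /= dP <-].
have [|tau ft e] := @eq_bigmax_cond _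
    [pred s | fourier_coef w chi f s != 0] (@weight q n).
  by apply/card_gt0P; exists sigma.
have -> : fourier_width w chi f = weight tau by exact: e.
rewrite lee_fin -[_%:R]/((Posz (weight tau))%:~R) ler_int leNgt.
by apply: contra ft => /dP ->.
Qed.

(** Sorting the indices by degree, rather than the degrees, retains which functions enter the sum;
    the nonzero coefficients make all degrees finite. *)
Lemma deg_minus2E (R : realType) (q k n : nat) (Omega : 'I_k -> finType)
    (mu : {dffun forall i : 'I_k, Omega i} -> R)
    (chi : forall i : 'I_k, 'I_q -> Omega i -> R[i])
    (f : forall i : 'I_k, {ffun 'I_n -> Omega i} -> R[i]) :
  (forall i, exists sigma, fourier_coef (marginal mu (i := i)) (chi i) (f i) sigma != 0) ->
  exists2 e : seq 'I_k, perm_eq e (enum 'I_k) &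
    deg_minus2 mu chi f = ((\sum_(i <- take (k - 2) e)
      fourier_width (marginal mu (i := i)) (chi i) (f i))%:R)%:E.
Proof.
move=> f0; rewrite /deg_minus2 sort_map.
set e := sort _ _; exists e; first by rewrite perm_sort.
rewrite -map_take big_map natr_sum -sumEFin.
by apply: eq_bigr => i _; have [sigma /fourier_degreeE ->] := f0 i.
Qed.

(* [A] is read by columns: [A j] is the [j]-th column of the multi-indices
   [row_of A i].  The order of [e] plays no role: the last two indices
   are bounded by the number of nontrivial columns. *)
Lemma sum_weight_le (k q n : nat) (A : {ffun 'I_n -> {ffun 'I_k -> 'I_q}})
    (e : seq 'I_k) (d : 'I_k -> nat) :
  perm_eq e (enum 'I_k) -> (1 < k)%N ->
  (forall j, supp (A j) != finset.set0 -> (2 < #|supp (A j)|)%N) ->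
  (forall i, weight (row_of A i) <= d i)%N ->
  (\sum_j #|supp (A j)| <= 3 * \sum_(i <- take (k - 2) e) d i)%N.
Proof.
move=> pe k2 A3 Ad; set D := (\sum_(i <- take _ _) _)%N.
have sum_e (F : 'I_k -> nat) : (\sum_(i < k) F i =
    \sum_(i <- take (k - 2) e) F i + \sum_(i <- drop (k - 2) e) F i)%N.
  by rewrite -big_cat cat_take_drop (perm_big _ pe) big_enum.
have size_drop : size (drop (k - 2) e) = 2%N.
  by rewrite size_drop (perm_size pe) size_enum_ord subKn.
have weightE i : weight (row_of A i) = (\sum_j (i \in supp (A j)))%N.
  rewrite /weight -sum1_card big_mkcond /=; apply: eq_bigr => j _.
  by rewrite !inE ffunE; case: (_ != _).
have cardE j : #|supp (A j)| = (\sum_i (i \in supp (A j)))%N.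
  by rewrite -sum1_card big_mkcond /=; apply: eq_bigr => i _; case: (_ \in _).
pose U := #|[set j | supp (A j) != finset.set0]|.
(* Of the three or more nonzero entries of a nontrivial column, at most two lie in the dropped rows,
   so one lies in a row counted by [D]. *)
have UD : (U <= D)%N.
  apply: (@leq_trans (\sum_(i <- take (k - 2) e) weight (row_of A i))%N).
    under [leqRHS]eq_bigr do rewrite weightE.
    rewrite exchange_big /= /U -sum1_card big_mkcond /=; apply: leq_sum => j _.
    rewrite inE; case: ifP => // /A3; rewrite cardE sum_e.
    have : (\sum_(i <- drop (k - 2) e) (i \in supp (A j)) <= 2)%N.
      rewrite -[X in (_ <= X)%N]size_drop -sum1_size.
      by apply: leq_sum => i _; case: (_ \in _).
    move=> le2 gt2; rewrite lt0n; apply: contraTneq gt2 => ->.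
    by rewrite add0n -leqNgt.
  by apply: leq_sum => i _.
have weightU i : (weight (row_of A i) <= U)%N.
  apply: subset_leq_card; apply/fintype.subsetP => j; rewrite !inE ffunE => ij.
  by apply/set0Pn; exists i; rewrite inE.
under eq_bigr do rewrite cardE.
rewrite exchange_big /=; under eq_bigr do rewrite -weightE.
rewrite sum_e; have : (\sum_(i <- drop (k - 2) e) weight (row_of A i) <= 2 * U)%N.
  rewrite -[X in (X * _)%N]size_drop -sum1_size big_distrl /=.
  by apply: leq_sum => i _; rewrite mul1n.
have : (\sum_(i <- take (k - 2) e) weight (row_of A i) <= D)%N.
  by apply: leq_sum => i _.
by move: UD; lia.
Qed.

(** * The main bound *)

Lemma max_coef_ge0 (R : realType) (q n : nat) (T : finType) (w : T -> R)
    (chi : 'I_q -> T -> R[i]) (f : {ffun 'I_n -> T} -> R[i]) :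
  0 <= max_coef w chi f.
Proof. exact: bigmax_ge_id. Qed.

Lemma fourier_coef_le_max (R : realType) (q n : nat) (T : finType) (w : T -> R)
    (chi : 'I_q -> T -> R[i]) (f : {ffun 'I_n -> T} -> R[i])
    (sigma : {ffun 'I_n -> 'I_q}) :
  cabs (fourier_coef w chi f sigma) <= max_coef w chi f.
Proof. exact: le_bigmax. Qed.

Lemma norm2_parseval (R : realType) (q n : nat) (T : finType) (w : T -> R)
    (chi : 'I_q -> T -> R[i]) (f : {ffun 'I_n -> T} -> R[i]) :
  fourier_basis w chi ->
  Num.sqrt (\sum_sigma cabs (fourier_coef w chi f sigma) ^+ 2) =
  norm2 (prod_distr w) f.
Proof.
move=> fb; congr Num.sqrt; apply: complete_parseval.
exact/complete_prod/fourier_basis_complete.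
Qed.

Lemma noisy_inner_bound (R : realType) (k q n : nat) (Omega : 'I_k -> finType)
    (mu : {dffun forall i : 'I_k, Omega i} -> R)
    (chi : forall i : 'I_k, 'I_q.+1 -> Omega i -> R[i]) (M c : R) (i1 : 'I_k)
    (f : forall i : 'I_k, {ffun 'I_n -> Omega i} -> R[i]) (e : seq 'I_k) :
  (1 < k)%N -> is_distr mu -> pairwise_independent mu ->
  (forall (i : 'I_k) (u : Omega i), 0 < marginal mu u) ->
  (forall i, fourier_basis (marginal mu (i := i)) (chi i)) ->
  (forall i s y, cabs (chi i s y) <= M) -> 1 <= M -> 1 <= c ->
  k%:R * Num.sqrt q%:R * M <= c -> perm_eq e (enum 'I_k) ->
  cabs (noisy_inner mu f) <=
    (c ^+ 3) ^+ (\sum_(i <- take (k - 2) e)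
                   fourier_width (marginal mu (i := i)) (chi i) (f i))
    * max_coef (marginal mu (i := i1)) (chi i1) (f i1)
    * \prod_(i < k | i != i1) norm2 (prod_distr (marginal mu (i := i))) (f i).
Proof.
move=> k2 mud pw m0 fb chiM M1 c1 kc pe.
set D := (\sum_(i <- take _ _) _)%N; set delta := max_coef _ _ _.
have M0 : 0 <= M by apply: le_trans M1.
have c0 : 0 < c by apply: lt_le_trans c1.
have ci0 : 0 <= c^-1 by rewrite invr_ge0 ltW.
pose fc i s := cabs (fourier_coef (marginal mu (i := i)) (chi i) (f i) s).
have fc0 i s : 0 <= fc i s by apply: cabs_ge0.
(* The discount [c^-1] per nonzero entry makes the one-column bound hold; [(c ^+ 3) ^+ D] pays it
   back. *)
pose K a := cabs (moment mu chi a) * c^-1 ^+ #|supp a|.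
have K0 a : 0 <= K a by rewrite mulr_ge0 ?cabs_ge0 ?exprn_ge0.
have column g : (forall i s, 0 <= g i s) ->
    \sum_a K a * \prod_(i | i != i1) g i (a i) <=
    \prod_(i | i != i1) Num.sqrt (\sum_s g i s ^+ 2).
  apply: (one_column (kappa := column_weight (Num.sqrt q%:R) M c)) => [r|r|a a1].
  - by apply: column_weight_ge0 => //; apply: sqrtr_ge0.
  - by apply: column_weight_le => //; apply: ltnW.
  - exact: moment_column.
have := nonneg_form_tensor K0 column (n := n) fc0.
have -> : \prod_(i < k | i != i1) Num.sqrt (\sum_s fc i s ^+ 2) =
    \prod_(i < k | i != i1) norm2 (prod_distr (marginal mu (i := i))) (f i).
  by apply: eq_bigr => i _; apply: norm2_parseval.
have delta0 : 0 <= (c ^+ 3) ^+ D * delta.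
  by rewrite mulr_ge0 ?max_coef_ge0// !exprn_ge0// ltW.
move=> /(ler_wpM2l delta0); apply: le_trans.
rewrite (noisy_expand _ (fun i => fourier_basis_complete (fb i))).
apply: le_trans (cabs_sum _ _ _) _; rewrite mulr_sumr; apply: ler_sum => A _.
rewrite cabsM !cabs_prod.
(* A vanishing term only needs a nonnegative right side; otherwise the nonzero moments and
   coefficients supply the hypotheses of [sum_weight_le]. *)
have [/forallP m_neq0|] := boolP [forall j, moment mu chi (A j) != 0]; last first.
  rewrite negb_forall => /existsP[j]; rewrite negbK => /eqP mj.
  rewrite (bigD1 j)//= mj cabs0 !mul0r mulr_ge0// mulr_ge0 ?prodr_ge0//.
have [f_neq0|/existsNP[i /negP]] := pselect (forall i,
    fourier_coef (marginal mu (i := i)) (chi i) (f i) (row_of A i) != 0); last first.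
  rewrite negbK => /eqP fi.
  rewrite [X in _ * X](bigD1 i)//= fi cabs0 mul0r mulr0.
  by rewrite mulr_ge0// mulr_ge0 ?prodr_ge0.
have supp_le : (\sum_j #|supp (A j)| <= 3 * D)%N.
  apply: sum_weight_le => // [j Aj|i]; last by apply: leq_bigmax_cond.
  rewrite ltnNge; apply: contra (m_neq0 j) => A2; apply/eqP.
  by apply: moment_supp12 => //; rewrite A2 andbT card_gt0.
rewrite [X in _ * X <= _](bigD1 i1)//= mulrA [leRHS]mulrA.
apply: ler_wpM2r; first by apply: prodr_ge0 => i _; apply: fc0.
have -> : \prod_j K (A j) = (\prod_j cabs (moment mu chi (A j))) *
    c^-1 ^+ (\sum_j #|supp (A j)|).
  by rewrite -prodrXr -big_split.
rewrite [_ * delta]mulrC mulrACA.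
rewrite mulrC -[leLHS]mulr1; apply: ler_pM => //.
- by rewrite mulr_ge0 ?cabs_ge0// prodr_ge0// => j _; apply: cabs_ge0.
- apply: ler_wpM2r; last exact: fourier_coef_le_max.
  by apply: prodr_ge0 => j _; apply: cabs_ge0.
- rewrite -exprM exprVn -[leLHS](divff (_ : c ^+ (3 * D) != 0)) ?expf_neq0 ?gt_eqF//.
  apply: ler_wpM2l; first by rewrite exprn_ge0// ltW.
  by rewrite lef_pV2 ?posrE ?exprn_gt0// ler_weXn2l.
Qed.

(** * Degenerate degrees and explicit constants *)

Lemma epow_ge0 (R : realType) (C : R) (D : \bar R) : 0 <= epow C D.
Proof. by case: D => //= r; apply: powR_ge0. Qed.

Lemma noisy_inner_epow (R : realType) (k q n : nat) (Omega : 'I_k -> finType)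
    (mu : {dffun forall i : 'I_k, Omega i} -> R)
    (chi : forall i : 'I_k, 'I_q.+1 -> Omega i -> R[i]) (M : R) (i1 : 'I_k)
    (f : forall i : 'I_k, {ffun 'I_n -> Omega i} -> R[i]) :
  (1 < k)%N -> is_distr mu -> pairwise_independent mu ->
  (forall (i : 'I_k) (u : Omega i), 0 < marginal mu u) ->
  (forall i, fourier_basis (marginal mu (i := i)) (chi i)) ->
  (forall i s y, cabs (chi i s y) <= M) -> 1 <= M ->
  cabs (noisy_inner mu f) <=
    epow ((k%:R * Num.sqrt q%:R * M) ^+ 3) (deg_minus2 mu chi f)
    * max_coef (marginal mu (i := i1)) (chi i1) (f i1)
    * \prod_(i < k | i != i1) norm2 (prod_distr (marginal mu (i := i))) (f i).
Proof.
move=> k2 mud pw m0 fb chiM M1.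
(* If all coefficients of some [f i] vanish, so does every term of the expansion, and the right side
   is nonnegative. *)
have [f_neq0|/existsNP[i /forallNP fi]] := pselect (forall i : 'I_k, exists sigma,
    fourier_coef (marginal mu (i := i)) (chi i) (f i) sigma != 0); last first.
  rewrite (noisy_expand _ (fun i => fourier_basis_complete (fb i))) big1.
    rewrite cabs0 !mulr_ge0 ?epow_ge0 ?max_coef_ge0//.
    by apply: prodr_ge0 => j _; apply: sqrtr_ge0.
  move=> A _; rewrite [X in _ * X](bigD1 i)//=.
  by have /negP := fi (row_of A i); rewrite negbK => /eqP ->; rewrite mul0r mulr0.
have [e pe ->] := deg_minus2E f_neq0.
set D := (\sum_(i <- take _ _) _)%N.
have M0 : 0 <= M by apply: le_trans M1.
have cM0 : 0 <= k%:R * Num.sqrt q%:R * M.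
  by rewrite mulr_ge0// mulr_ge0// sqrtr_ge0.
rewrite /epow powR_mulrn ?exprn_ge0//.
(* [q] is the paper's [q - 1]; if it is [0], so is the constant, but then [D = 0]
   and the bound with [c = 1] suffices. *)
case: (posnP q) => [q0|q0].
  have D0 : D = 0%N.
    rewrite /D big1// => i _; apply/eqP; rewrite -leqn0; apply/bigmax_leqP => s _.
    rewrite leqn0 /weight cards_eq0; apply/eqP/setP => j; rewrite !inE.
    by have := ltn_ord (s j); rewrite [X in (_ < X.+1)%N]q0 ltnS leqn0 => ->.
  have := noisy_inner_bound i1 f k2 mud pw m0 fb chiM M1 (lexx 1).
  rewrite {1}q0 sqrtr0 mulr0 mul0r => /(_ e ler01 pe).
  by rewrite -/D D0 !expr0.
(* Here [c] is [k%:R * Num.sqrt q%:R * M] itself, at least 1 since its three factors are. *)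
apply: noisy_inner_bound => //.
rewrite -[leLHS]mulr1; apply: ler_pM => //.
rewrite -[leLHS]mulr1; apply: ler_pM => //; first by rewrite ler1n ltnW.
by rewrite -[leLHS]sqrtr1 ler_wsqrtr// ler1n.
Qed.

Lemma min_marginal_atom_bounds (R : realType) (k : nat) (Omega : 'I_k -> finType)
    (mu : {dffun forall i : 'I_k, Omega i} -> R) :
  (forall (i : 'I_k) (u : Omega i), 0 < marginal mu u) ->
  [/\ 0 < min_marginal_atom mu, min_marginal_atom mu <= 1 &
    forall (i : 'I_k) (u : Omega i), min_marginal_atom mu <= marginal mu u].
Proof.
move=> m0; split.
- apply/bigmin_gtP; split => // i _; apply/bigmin_gtP; split => // u _.
- exact: bigmin_le_id.
- move=> i u; apply: le_trans (_ : min_atom (marginal mu (i := i)) <= _).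
    exact: bigmin_le.
  by apply: bigmin_le_cond; rewrite gt_eqF.
Qed.

Theorem theorem3p2 (R : realType) (k q : nat) (hk : (2 <= k)%N)
  (hq : (1 <= q)%N) (Omega : 'I_k -> finType)
  (hOmega : forall i, #|Omega i| = q)
  (mu : {dffun forall i : 'I_k, Omega i} -> R)
  (mu_distr : is_distr mu)
  (mu_pairwise : pairwise_independent mu)
  (mu_pos : forall (i : 'I_k) (a : Omega i), 0 < marginal mu a) :
  let i1 : 'I_k := Ordinal (ltnW hk) in
  [/\ exists2 C : R, 0 <= C &
        forall (n : nat) (chi : forall i : 'I_k, 'I_q -> Omega i -> R[i]),
        (forall i, fourier_basis (marginal mu (i := i)) (chi i)) ->
        forall f : forall i : 'I_k, {ffun 'I_n -> Omega i} -> R[i],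
        cabs (noisy_inner mu f) <=
          epow C (deg_minus2 mu chi f)
          * max_coef (marginal mu (i := i1)) (chi i1) (f i1)
          * \prod_(i < k | i != i1) norm2 (prod_distr (marginal mu (i := i))) (f i),
      forall (n : nat) (chi : forall i : 'I_k, 'I_q -> Omega i -> R[i]),
        (forall i, fourier_basis (marginal mu (i := i)) (chi i)) ->
        forall f : forall i : 'I_k, {ffun 'I_n -> Omega i} -> R[i],
        cabs (noisy_inner mu f) <=
          epow ((k%:R * Num.sqrt ((q%:R - 1) / min_marginal_atom mu)) ^+ 3)
            (deg_minus2 mu chi f)
          * max_coef (marginal mu (i := i1)) (chi i1) (f i1)
          * \prod_(i < k | i != i1) norm2 (prod_distr (marginal mu (i := i))) (f i)
    & (forall (i : 'I_k) (a : Omega i), marginal mu a = q%:R^-1) ->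
        exists2 chi : forall i : 'I_k, 'I_q -> Omega i -> R[i],
          forall i, fourier_basis (marginal mu (i := i)) (chi i) &
          forall (n : nat) (f : forall i : 'I_k, {ffun 'I_n -> Omega i} -> R[i]),
          cabs (noisy_inner mu f) <=
            epow ((k%:R * Num.sqrt (q%:R - 1)) ^+ 3) (deg_minus2 mu chi f)
            * max_coef (marginal mu (i := i1)) (chi i1) (f i1)
            * \prod_(i < k | i != i1)
                norm2 (prod_distr (marginal mu (i := i))) (f i)].
Proof.
move=> i1; case: q hq hOmega => [//|r] _ cardO.
have q1 : r.+1%:R - 1 = r%:R :> R by rewrite -natr1 addrK.
set alpha := min_marginal_atom mu.
have [alpha0 alpha1 alpha_le] := min_marginal_atom_bounds mu_pos.
have bound n (chi : forall i : 'I_k, 'I_r.+1 -> Omega i -> R[i]) :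
    (forall i, fourier_basis (marginal mu (i := i)) (chi i)) ->
    forall f : forall i : 'I_k, {ffun 'I_n -> Omega i} -> R[i],
    cabs (noisy_inner mu f) <=
      epow ((k%:R * Num.sqrt ((r.+1%:R - 1) / alpha)) ^+ 3) (deg_minus2 mu chi f)
      * max_coef (marginal mu (i := i1)) (chi i1) (f i1)
      * \prod_(i < k | i != i1) norm2 (prod_distr (marginal mu (i := i))) (f i).
  (* Splitting the root exhibits [M = Num.sqrt alpha^-1], which bounds the characters by
     [complete_bound]. *)
  move=> fb f; rewrite q1 sqrtrM// mulrA.
  apply: noisy_inner_epow => // [i s y|].
    rewrite -[leLHS]ger0_norm ?cabs_ge0// -sqrtr_sqr ler_wsqrtr//.
    apply: (@le_trans _ _ (marginal mu y)^-1).
      exact: complete_bound (fourier_basis_complete (fb i)) (mu_pos i y).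
    by rewrite lef_pV2 ?posrE.
  by rewrite -[leLHS]sqrtr1 ler_wsqrtr// invf_ge1.
split=> //.
  by exists ((k%:R * Num.sqrt ((r.+1%:R - 1) / alpha)) ^+ 3).
move=> unif.
have basis i := cid2 (uniform_fourier_basis (cardO i) (unif i)).
exists (fun i => s2val (basis i)) => [i|n f]; first exact: s2valP (basis i).
(* These characters have absolute value 1, so [M = 1] and [alpha] disappears from the constant. *)
have := noisy_inner_epow i1 f hk mu_distr mu_pairwise mu_pos
  (fun i => s2valP (basis i)) (M := 1).
rewrite q1 mulr1; apply => // i s y.
by rewrite (s2valP' (basis i)).
Qed.
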